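(* Let $\mathcal{C}$ be an $[n,k,d]_{q^m/q}$ code. If $\mathcal{C}$ is rank-nondegenerate, then $$\mathbb{E}^{\mathrm{rk}}[q^{n-\mathcal{C}^*}]=\frac{-q^n+q^{mk}+q^{m(k-1)}(q^n-1)}{q^{mk}-1},$$ $$\mathrm{Var}^{\mathrm{rk}}[q^{n-\mathcal{C}^*}]\ \ge\ \frac{-q^{2n}+f_q(n,m,k,0,2)}{q^{mk}-1}-\mathbb{E}^{\mathrm{rk}}[q^{n-\mathcal{C}^*}]^2,$$ where the latter lower bound is attained with equality if and only if $\mathcal{C}$ is rank-2-nondegenerate.
   Context: Let $q$ be a prime power and $n,m,k$ positive integers. For $v\in\mathbb{F}_{q^m}^n$ and an ordered basis $\Gamma=(\gamma_1,\dots,\gamma_m)$ of $\mathbb{F}_{q^m}$ over $\mathbb{F}_q$, let $\Gamma(v)\in\mathbb{F}_q^{n\times m}$ be the matrix with $v_i=\sum_{j}\Gamma(v)_{ij}\gamma_j$. The rank support $\sigma^{\mathrm{rk}}(v)\subseteq\mathbb{F}_q^n$ is the column space of $\Gamma(v)$ (independent of $\Gamma$), and $\mathrm{rk}(v)=\dim_{\mathbb{F}_q}\sigma^{\mathrm{rk}}(v)$. An $[n,k,d]_{q^m/q}$ code is a $k$-dimensional $\mathbb{F}_{q^m}$-subspace $\mathcal{C}\subseteq\mathbb{F}_{q^m}^n$ whose minimum rank distance $d^{\mathrm{rk}}(\mathcal{C})=\min\{\mathrm{rk}(v): v\in\mathcal{C}, v\ne0\}$ equals $d$; the zero code in $\mathbb{F}_{q^m}^n$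 has minimum distance $n+1$ by convention. The code is rank-nondegenerate if $\sum_{v\in\mathcal{C}}\sigma^{\mathrm{rk}}(v)=\mathbb{F}_q^n$. With $\mathcal{C}^\perp=\{v\in\mathbb{F}_{q^m}^n: u v^\top=0 \ \forall u\in\mathcal{C}\}$, the code $\mathcal{C}$ is rank-2-nondegenerate if $d^{\mathrm{rk}}(\mathcal{C}^\perp)\ge 3$. $\mathcal{C}^*$ denotes the random variable $\mathrm{rk}(v)$, where $v$ is a uniformly random nonzero codeword of $\mathcal{C}$; $\mathbb{E}^{\mathrm{rk}}$ and $\mathrm{Var}^{\mathrm{rk}}$ denote mean and variance of (a function of) $\mathcal{C}^*$. Thus $\mathbb{E}^{\mathrm{rk}}[q^{n-\mathcal{C}^*}]=\frac{1}{q^{mk}-1}\sum_{v\in\mathcal{C}\setminus\{0\}}q^{n-\mathrm{rk}(v)}$. Finally, $$f_q(n,m,k,j,r)=\sum_{\nu=j}^r q^{m(k-\nu)}\binom{n-j}{\nu-j}_q\binom{r}{\nu}_q\prod_{\ell=0}^{\nu-1}(q^\nu-q^\ell),$$ where $\binom{a}{b}_q$ is the Gaussian binomial coefficient (the number of $b$-dimensional subspaces of an $a$-dimensional $\mathbb{F}_q$-space).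
   Formalization: The equality criterion is stated only for n ≥ 2: for n = 1 the code is F_{q^m}, its dual is zero with distance n+1 = 2 < 3, so it is not rank-2-nondegenerate, yet the variance and the bound are both 0. The mean formula and the inequality are stated for all n ≥ 1. *)

(* Defs.v *)
From HB Require Import structures.
From mathcomp Require Import all_boot all_order all_algebra all_field.

Set Implicit Arguments.
Unset Strict Implicit.
Unset Printing Implicit Defensive.

Import Order.TTheory GRing.Theory Num.Theory.
Local Open Scope ring_scope.

(* F is the field with q elements, L its extension of degree m = \dim {:L}.   *)
(* The alias finvect_type L of L carries the finType structure needed to sum  *)
(* over codewords. Vectors of F^n are columns, vectors of L^n (hence          *)
(* codewords) are rows.                                                       *)

Section RankMetric.

Variables (F : finFieldType) (L : fieldExtType F) (n : nat).
Local Notation K := (finvect_type L).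
Implicit Types (G : (\dim {:L}).-tuple L) (v : 'rV[K]_n).
Implicit Type C : {vspace 'rV[K]_n}.

Definition expansion G v : 'M[F]_(n, \dim {:L}) :=
  \matrix_(i, j) coord G j (v 0 i : L).

Definition col_space G v : {vspace 'cV[F]_n} :=
  <<[seq col j (expansion G v) | j : 'I_(\dim {:L})]>>%VS.

(* The choice of the basis is immaterial, see rk_suppE. *)
Definition rk_supp v : {vspace 'cV[F]_n} := col_space (vbasis {:L}) v.

Definition rk v : nat := \dim (rk_supp v).

Definition nonzero_words C : {set 'rV[K]_n} := [set v in C | v != 0].

(* As rk v <= n, the initial value n.+1 only matters when there is no nonzero *)
(* codeword: the zero code has minimum distance n + 1.                        *)
Definition min_rk_dist C : nat :=
  \big[minn/n.+1]_(v in nonzero_words C) rk v.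

Definition dual_code C : {vspace 'rV[K]_n} :=
  (\bigcap_(u : 'rV[K]_n | u \in C) lker (linfun (mulmx u \o trmx)))%VS.

Definition rk_nondegenerate C : Prop :=
  (\sum_(v : 'rV[K]_n | v \in C) rk_supp v)%VS = fullv.

Definition rk_2_nondegenerate C : Prop := (3 <= min_rk_dist (dual_code C))%N.

(* Mean and variance of g (rk v) for v uniform among the nonzero codewords.   *)
Definition rk_mean C (g : nat -> rat) : rat :=
  (\sum_(v in nonzero_words C) g (rk v)) / #|nonzero_words C|%:R.

Definition rk_variance C (g : nat -> rat) : rat :=
  rk_mean C (fun w => (g w - rk_mean C g) ^+ 2).

Lemma mem_dual_code C v :
  reflect (forall u : 'rV[K]_n, u \in C -> u *m v^T = 0) (v \in dual_code C).
Proof.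
rewrite memvE; apply: (iffP subv_bigcapP) => [h u uC | h u uC].
  by have := h u uC; rewrite -memvE memv_ker lfunE => /eqP.
by rewrite -memvE memv_ker lfunE /= h.
Qed.

Lemma col_space_sub G1 G2 v :
  basis_of {:L} G2 -> (col_space G1 v <= col_space G2 v)%VS.
Proof.
move=> bG2; apply/span_subvP => _ /imageP[j _ ->].
have -> : col j (expansion G1 v) =
    \sum_(l < \dim {:L}) coord G1 j (G2`_l) *: col l (expansion G2 v).
  apply/colP => i; rewrite summxE !mxE {1}(coord_basis bG2 (memvf (v 0 i : L))).
  rewrite linear_sum; apply: eq_bigr => l _.
  by rewrite linearZ !mxE mulrC.
by apply: memv_suml => l _; apply/memvZ/memv_span/image_f.
Qed.

Lemma rk_suppE G v : basis_of {:L} G -> rk_supp v = col_space G v.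
Proof.
move=> bG; apply/eqP; rewrite eqEsubv !col_space_sub //.
exact: vbasisP.
Qed.

End RankMetric.

Section Counting.

Variable F : finFieldType.

(* Gaussian binomial coefficient for q = #|F|: the number of b-dimensional    *)
(* subspaces of F^a, each of them being the row space of some a x a matrix.   *)
Definition gauss_binom (a b : nat) : nat :=
  #|[set [set x : 'rV[F]_a | (x <= U)%MS] | U : 'M[F]_a & \rank U == b]|.

(* The exponent m (k - nu) is an integer: it is negative if nu > k.           *)
Definition f_q (n m k j r : nat) : rat :=
  \sum_(j <= nu < r.+1)
    #|F|%:R ^ (m%:Z * (k%:Z - nu%:Z))
    * (gauss_binom (n - j) (nu - j))%:R * (gauss_binom r nu)%:R
    * \prod_(l < nu) (#|F|%:R ^+ nu - #|F|%:R ^+ l).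

End Counting.

(* Main.v *)
Require Import Defs.
From HB Require Import structures.
From mathcomp Require Import all_boot all_order all_algebra all_field.
From mathcomp Require Import ring.

Set Implicit Arguments.
Unset Strict Implicit.
Unset Printing Implicit Defensive.

Import Order.TTheory GRing.Theory Num.Theory.
Local Open Scope ring_scope.

(* Write q = |F|, m = [L : F], k = dim C and let B be a generator matrix of C. *)
(* For a word v, q^(a (n - rk v)) is the number of a x n matrices M over F    *)
(* with M v^T = 0. Double counting pairs (M, v) turns the a-th moment of      *)
(* q^(n - rk v) over C into the sum over all M of q^(m (k - r(M))), where     *)
(* r(M) is the rank of M B^T over L. If C is nondegenerate then r(M) = rk M   *)
(* as soon as rk M <= 1, which settles a = 1. For a = 2 only the matrices of  *)
(* rank 2 remain, each contributing at least q^(m (k - 2)), with equality iff *)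
(* r(M) = 2. Equality for all M means that no nonzero L-combination of two    *)
(* rows over F lies in the dual code; these combinations are exactly the      *)
(* words of rank at most 2, provided n >= 2.                                  *)

(** The double counting is [sum_rk_moment]: it trades the ranks of the codewords for the ranks of
    [eval_mx C M], which nondegeneracy determines when [M] has rank at most 1 ([rank_eval_mx1]).
    Counting matrices by rank ([card_row_free], [gauss_binomE]) shows that the [nu]-th term of
    [f_q F n m k 0 2] is q^(m (k - nu)) times the number of 2 x n matrices of rank [nu]. Hence
    [code_moment2] writes the second moment as [f_q] plus a sum of excesses over the matrices of
    rank 2. Each excess is nonnegative, which gives the bound once the zero word and the squared
    mean are subtracted. Equality forces every excess to vanish, and [rk_2_nondegenerateP] reads
    this as the condition on the dual code. *)

Section MatrixCounting.

(** * Counting matrices and subspaces over a finite field *)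

Variable E : finFieldType.

(** The rows of such an [M] range independently over the left kernel of [A]; coordinates in a basis
    of that kernel give the bijection. *)
Lemma card_mulmx_ker a p r (A : 'M[E]_(p, r)) :
  #|[set M : 'M[E]_(a, p) | M *m A == 0]| = (#|E| ^ (a * (p - \rank A)))%N.
Proof.
rewrite -mxrank_ker -card_mx -cardsT.
rewrite -(card_imset _ (row_free_inj (row_base_free (kermx A)))).
apply: eq_card => M; rewrite !inE; apply/eqP/imsetP => [/sub_kermxP | [X _ ->]].
  by rewrite -(eq_row_base (kermx A)) => /submxP[X ->]; exists X.
by apply/sub_kermxP; rewrite (submx_trans (submxMl _ _)) ?eq_row_base.
Qed.

Lemma card_rowspace n r (A : 'M[E]_(r, n)) :
  #|[set x : 'rV[E]_n | (x <= A)%MS]| = (#|E| ^ \rank A)%N.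
Proof.
rewrite -[\rank A]mul1n -card_mx -cardsT.
rewrite -(card_imset _ (row_free_inj (row_base_free A))).
apply: eq_card => x; rewrite !inE -(eq_row_base A).
by apply/submxP/imsetP => [[X ->] | [X _ ->]]; exists X.
Qed.

Lemma row_free_col_mx n b (y : 'rV[E]_n) (M : 'M[E]_(b, n)) :
  row_free (col_mx y M) = row_free M && ~~ (y <= M)%MS.
Proof.
rewrite -!row_leq_rank -addsmxE; case: (boolP (y <= M)%MS) => yM.
  by rewrite (addsmx_idPr yM) andbF leqNgt ltnS rank_leq_row.
have [y0 | ny0] := eqVneq y 0; first by rewrite y0 sub0mx in yM.
rewrite andbT.
have cap0 : \rank (y :&: M)%MS = 0%N.
  (* A nonzero intersection with the line spanned by [y] is the whole line. *)
  apply/eqP; rewrite -leqn0 leqNgt; apply: contra yM => rk_cap.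
  have sub : (y <= y :&: M)%MS.
    by rewrite -(geq_leqif (mxrank_leqif_sup (capmxSl y M))) rank_rV ny0.
  exact: submx_trans sub (capmxSr _ _).
have := mxrank_sum_cap y M; rewrite cap0 addn0 rank_rV ny0 => ->.
by rewrite leq_add2l.
Qed.

(** A free [M] with [b] rows extends by any [y] outside its row space, which has q^b elements. For b
    > n the factor l = n makes the product vanish, as it should. *)
Lemma card_row_free b n :
  (#|[set M : 'M[E]_(b, n) | row_free M]|
     = \prod_(l < b) (#|E| ^ n - #|E| ^ l))%N.
Proof.
elim: b => [|b IH].
  rewrite big_ord0 (eq_card (B := predT)) => [|M]; first by rewrite card_mx.
  by rewrite !inE -row_leq_rank leq0n.
rewrite big_ord_recr /= -{}IH.
pose f (z : 'M[E]_(b, n) * 'rV[E]_n) : 'M[E]_(1 + b, n) := col_mx z.2 z.1.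
have f_inj : injective f by case=> M y [M' y']; rewrite /f => /eq_col_mx[/= -> ->].
transitivity #|[set z | row_free (f z)]|.
  rewrite -(card_imset _ f_inj); apply: eq_card => M.
  rewrite !inE; apply/idP/imsetP => [Mfree | [z zfree ->]].
    exists (dsubmx (M : 'M_(1 + b, n)), usubmx (M : 'M_(1 + b, n))).
      by rewrite inE /f vsubmxK.
    by rewrite /f vsubmxK.
  by rewrite inE in zfree.
rewrite -sum1_card.
rewrite (eq_bigl (fun z => row_free z.1 && ~~ (z.2 <= z.1)%MS)); last first.
  by move=> z; rewrite !inE row_free_col_mx.
rewrite -(pair_big_dep (fun M : 'M_(b, n) => row_free M)
  (fun M (y : 'rV_n) => ~~ (y <= M)%MS) (fun _ _ => 1%N)) /=.
rewrite -sum_nat_const; apply: eq_big => M; first by rewrite inE.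
move=> Mfree; rewrite sum1_card.
have := cardC (fun y : 'rV_n => (y <= M)%MS); rewrite card_mx mul1n => <-.
have := card_rowspace M; rewrite (eqP Mfree) => <-.
by rewrite cardsE addKn; apply: eq_card => y; rewrite !inE.
Qed.

Lemma card_eqmx_row_free b n (U : 'M[E]_(b, n)) : row_free U ->
  #|[set M : 'M[E]_(b, n) | row_free M & (M == U)%MS]|
    = #|[set A : 'M[E]_b | row_free A]|.
Proof.
move=> Ufree; rewrite -(card_imset _ (row_free_inj Ufree)).
apply: eq_card => M; rewrite !inE; apply/andP/imsetP => [[Mfree] | [A]].
  case/andP=> /submxP[A MA] _; exists A => //; rewrite inE.
  by move: Mfree; rewrite MA /row_free mxrankMfree.
rewrite inE => Afree ->; have := Afree; rewrite row_free_unit -row_full_unit => Aunit.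
rewrite -[row_free (A *m U)]/(\rank _ == b) mxrankMfree //; split=> //.
exact/eqmxP/eqmxMfull.
Qed.

(** Free b x n matrices are sorted by their row space; each space of dimension [b] has as many
    ordered bases as there are invertible b x b matrices. *)
Lemma gauss_binom_mul n b :
  (gauss_binom E n b * #|[set A : 'M[E]_b | row_free A]|
     = #|[set M : 'M[E]_(b, n) | row_free M]|)%N.
Proof.
pose rs p (M : 'M[E]_(p, n)) := [set x : 'rV[E]_n | (x <= M)%MS].
have rsP p p' (M : 'M_(p, n)) (M' : 'M_(p', n)) :
    (rs p M == rs p' M') = (M == M')%MS.
  apply/eqP/idP => [/setP eqM | /eqmxP eqM].
    by apply/andP; split; apply/rV_subP => x; have := eqM x; rewrite !inE => ->.
  by apply/setP => x; rewrite !inE eqM.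
rewrite -[RHS]sum1_card.
rewrite (partition_big (@rs b)
  (mem [set rs n U | U : 'M_n & \rank U == b])) /=; last first.
  move=> M; rewrite inE => Mfree; apply/imsetP; exists <<M>>%MS.
    by rewrite inE genmxE; apply: Mfree.
  by apply/eqP; rewrite rsP; apply/eqmxP; apply: eqmx_sym; apply: genmxE.
rewrite -sum_nat_const; apply: eq_bigr => _ /imsetP[U + ->].
rewrite inE => /eqP rkU; subst b.
rewrite sum1_card -(card_eqmx_row_free (row_base_free U)).
apply: eq_card => M; rewrite !inE -!topredE /= inE rsP.
by rewrite !eq_row_base.
Qed.

Lemma gauss_binomE n b :
  (gauss_binom E n b * \prod_(l < b) (#|E| ^ b - #|E| ^ l)
     = \prod_(l < b) (#|E| ^ n - #|E| ^ l))%N.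
Proof. by rewrite -!card_row_free gauss_binom_mul. Qed.

End MatrixCounting.

(** * Rank weight as a matrix rank, and supports *)

Section RankMetric.

Variables (F : finFieldType) (L : fieldExtType F).
Local Notation K := (finvect_type L).
Local Notation m := (\dim {:L}).
Local Notation "M ^K" := (map_mx (in_alg K) M) (at level 2, format "M ^K").
Local Notation Ex := (expansion (vbasis {:L})).

Lemma card_finvect : #|K| = (#|F| ^ m)%N.
Proof.
by rewrite -(card_vspace (fullv : {vspace K})); apply: eq_card => x; rewrite memvf.
Qed.

Lemma expansion_mul n p (G : m.-tuple L) (v : 'rV[K]_p) (N : 'M[F]_(p, n)) :
  expansion G (v *m N^K) = N^T *m expansion G v.
Proof.
apply/matrixP => i j; rewrite !mxE [LHS]linear_sum; apply: eq_bigr => l _.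
by rewrite !mxE -[v 0 l * _]/((v 0 l : L) * in_alg L (N l i)) mulr_algr linearZ.
Qed.

Lemma expansion_eq0 n (v : 'rV[K]_n) : (Ex v == 0) = (v == 0).
Proof.
apply/eqP/eqP => [Ev0 | ->].
  apply/rowP => i; rewrite [LHS](coord_vbasis (memvf (v 0 i : L))) mxE.
  apply: big1 => j _; have /matrixP/(_ i j) := Ev0.
  by rewrite !mxE => ->; rewrite scale0r.
by apply/matrixP => i j; rewrite !mxE linear0.
Qed.

(** A vector space dimension is compared with a matrix rank through cardinalities: both spaces are
    finite, and transposition maps the column span to a row space. *)
Lemma rkE n (v : 'rV[K]_n) : rk v = \rank (Ex v).
Proof.
have q_gt1 : (1 < #|F|)%N by exact: finNzRing_gt1.
apply/eqP; rewrite -(eqn_exp2l _ _ q_gt1); apply/eqP.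
rewrite -card_vspace -mxrank_tr -card_rowspace -(card_imset _ (@trmx_inj F n 1)).
apply: eq_card => y; rewrite /rk_supp /col_space.
rewrite inE; apply/imsetP/submxP => [[x] | [z ->]].
  rewrite span_def big_image /= => /memv_sumP[u uP ->] ->.
  apply/submxP; rewrite linear_sum; apply: summx_sub => j _.
  have /vlineP[c ->] := uP j isT.
  by rewrite linearZ /= tr_col scalemx_sub // row_sub.
exists (Ex v *m z^T); last by rewrite trmx_mul trmxK.
rewrite -[Ex v *m _]trmxK trmx_mul trmxK mulmx_sum_row linear_sum.
apply: memv_suml => j _; rewrite linearZ /= tr_row trmxK.
by apply/memvZ/memv_span/image_f.
Qed.

Lemma mulmx_lift_tr_eq0 n a (M : 'M[F]_(a, n)) (v : 'rV[K]_n) :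
  (M^K *m v^T == 0) = (M *m Ex v == 0).
Proof.
rewrite -[M in RHS]trmxK -expansion_mul expansion_eq0.
by rewrite -map_trmx -(inj_eq trmx_inj) trmx_mul !trmxK trmx0.
Qed.

(** The functional given by [y] kills every rank support, hence their sum, which is all of F^n. *)
Lemma rk_nondegenerate_ker n (C : {vspace 'rV[K]_n}) (y : 'rV[F]_n) :
  rk_nondegenerate C ->
  (forall v, v \in C -> y^K *m v^T = 0) -> y = 0.
Proof.
move=> ndC y0.
have full : (fullv <= lker (linfun (mulmx y : 'cV[F]_n -> 'cV[F]_1)))%VS.
  rewrite -ndC; apply/subv_sumP => v vC.
  apply/span_subvP => _ /imageP[j _ ->].
  rewrite memv_ker lfunE /=.
  have /eqP := y0 v vC; rewrite mulmx_lift_tr_eq0 => /eqP yE.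
  by rewrite colE mulmxA yE mul0mx.
apply/trmx_inj/colP => i; rewrite trmx0.
have := subvP full (delta_mx i 0) (memvf _).
rewrite memv_ker lfunE /= => /eqP /matrixP /(_ 0 0).
by rewrite -colE !mxE.
Qed.

Lemma min_rk_dist_geP n (D : {vspace 'rV[K]_n}) d :
  reflect ((d <= n.+1)%N /\ forall v, v \in D -> v != 0 -> (d <= rk v)%N)
          (d <= min_rk_dist D)%N.
Proof.
rewrite /min_rk_dist -minEnat -leEnat.
apply: (iffP (bigmin_geP _ _ _ _)) => [[dn dD] | [dn dD]]; split=> // v.
  by move=> vD v0; apply: dD; rewrite inE vD.
by rewrite inE => /andP[vD v0]; apply: dD.
Qed.

(** * Double counting over a code, and the dual code *)

Section Code.

Variables (n : nat) (C : {vspace 'rV[K]_n}).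

Definition gen_mx : 'M[K]_(\dim C, n) := \matrix_i (vbasis C)`_i.

Lemma gen_mx_free : row_free gen_mx.
Proof.
rewrite -kermx_eq0; apply/rowV0P => x /sub_kermxP; rewrite mulmx_sum_row => x0.
apply/rowP => i; rewrite mxE.
have /freeP free_basis := basis_free (vbasisP C).
apply: (free_basis (fun j => x 0 j)).
by rewrite -[RHS]x0; apply: eq_bigr => j _; rewrite rowK.
Qed.

Lemma mem_gen_mx v : (v \in C) = (v <= gen_mx)%MS.
Proof.
apply/idP/submxP => [/coord_vbasis -> | [x ->]].
  exists (\row_i coord (vbasis C) i v); rewrite mulmx_sum_row.
  by apply: eq_bigr => i _; rewrite rowK mxE.
rewrite mulmx_sum_row; apply: memv_suml => i _; rewrite rowK.
by apply/memvZ/vbasis_mem/mem_nth; rewrite size_tuple.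
Qed.

(* Its columns are the images of a basis of C under v |-> M *m v^T. *)
Definition eval_mx a (M : 'M[F]_(a, n)) := M^K *m gen_mx^T.

Lemma mulmx_eval_dual a (M : 'M[F]_(a, n)) (w : 'rV[K]_a) :
  (w *m eval_mx M == 0) = (w *m M^K \in dual_code C).
Proof.
rewrite /eval_mx mulmxA; apply/eqP/mem_dual_code => [w0 u | w0].
  rewrite mem_gen_mx => /submxP[x ->].
  by rewrite -mulmxA -[gen_mx *m _]trmxK trmx_mul trmxK w0 trmx0 mulmx0.
apply: trmx_inj; rewrite trmx_mul trmxK trmx0; apply/row_matrixP => i.
by rewrite row_mul row0 w0 // mem_gen_mx row_sub.
Qed.

(** Writing v = x B with B = [gen_mx], the condition becomes that [x] lies in the left kernel of the
    transpose of [eval_mx M]. *)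
Lemma card_code_ker a (M : 'M[F]_(a, n)) :
  #|[set v : 'rV[K]_n | (v \in C) && (M^K *m v^T == 0)]|
    = (#|F| ^ (m * (\dim C - \rank (eval_mx M))))%N.
Proof.
rewrite expnM -card_finvect -[(_ - _)%N]mul1n -mxrank_tr -card_mulmx_ker.
rewrite -(card_imset _ (row_free_inj gen_mx_free)).
have ker x : (M^K *m (x *m gen_mx)^T == 0) = (x *m (eval_mx M)^T == 0).
  by rewrite -[RHS](inj_eq trmx_inj) trmx0 !trmx_mul !trmxK mulmxA.
apply: eq_card => v; rewrite inE; apply/andP/imsetP => [[] | [x]].
  by rewrite mem_gen_mx => /submxP[x ->]; rewrite ker => x0; exists x; rewrite ?inE.
by rewrite inE -ker => x0 ->; rewrite mem_gen_mx submxMl.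
Qed.

Lemma card_rk_ker a v :
  #|[set M : 'M[F]_(a, n) | M^K *m v^T == 0]| = (#|F| ^ (a * (n - rk v)))%N.
Proof.
rewrite rkE -card_mulmx_ker; apply: eq_card => M.
by rewrite !inE mulmx_lift_tr_eq0.
Qed.

Lemma sum_rk_moment a :
  (\sum_(v in C) #|F| ^ (a * (n - rk v))
     = \sum_(M : 'M[F]_(a, n)) #|F| ^ (m * (\dim C - \rank (eval_mx M))))%N.
Proof.
under eq_bigr do rewrite -card_rk_ker -sum1_card.
under [RHS]eq_bigr do rewrite -card_code_ker -sum1_card.
rewrite (exchange_big_dep xpredT) //=; apply: eq_bigr => M _.
by apply: eq_bigl => v; rewrite !inE.
Qed.

Lemma rank_eval_mx_le a (M : 'M[F]_(a, n)) : (\rank (eval_mx M) <= \rank M)%N.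
Proof. by rewrite (leq_trans (mxrankM_maxl _ _)) // mxrank_map. Qed.

Lemma rank_eval_mx1 a (M : 'M[F]_(a, n)) :
  rk_nondegenerate C -> (\rank M <= 1)%N -> \rank (eval_mx M) = \rank M.
Proof.
move=> ndC rkM1; apply/eqP; rewrite eqn_leq rank_eval_mx_le /=.
have [-> | M0] := eqVneq M 0; first by rewrite mxrank0.
apply: (leq_trans rkM1); rewrite lt0n mxrank_eq0; apply: contraNneq M0 => ev0.
apply/eqP/row_matrixP => i; rewrite row0; apply: (rk_nondegenerate_ker ndC) => v.
rewrite mem_gen_mx => /submxP[x ->]; rewrite map_row -row_mul trmx_mul mulmxA.
by rewrite -/(eval_mx M) ev0 mul0mx row0.
Qed.

(** By [mulmx_eval_dual], a left kernel vector [w] of [eval_mx M] is a dual word w M, of rank at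
    most 2. Conversely, a rank factorization writes every word of rank at most 2 in this form. *)
Lemma rk_2_nondegenerateP :
  (2 <= n)%N ->
  rk_2_nondegenerate C <->
  forall M : 'M[F]_(2, n), row_free M -> row_free (eval_mx M).
Proof.
move=> n2; split=> [/min_rk_dist_geP[_ dual3] M Mfree | evfree].
  rewrite -kermx_eq0; apply/rowV0P => w /sub_kermxP/eqP.
  rewrite mulmx_eval_dual => wM; apply/eqP/negPn/negP => w0.
  have wM0 : w *m M^K != 0 by rewrite mulmx_free_eq0 ?row_free_map.
  have := dual3 _ wM wM0; apply/negP; rewrite -leqNgt.
  rewrite rkE expansion_mul (leq_trans (mxrankM_maxl _ _)) //.
  by rewrite mxrank_tr rank_leq_row.
(* Here n >= 2 gives 3 <= n + 1, which covers a zero dual code; it also leaves room below for two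
   independent columns. *)
apply/min_rk_dist_geP; split=> // v vD; apply: contraNleq => rk3.
have rk2 : (rk v <= 2)%N by [].
(* Taking two columns of the invertible factor keeps [B] of rank 2 even when [rk v] is smaller; the
   true rank is carried by [D]. *)
pose B : 'M_(n, 2) := col_ebase (Ex v) *m pid_mx 2.
pose D : 'M_(2, m) := pid_mx (rk v) *m row_ebase (Ex v).
have ExBD : Ex v = B *m D.
  rewrite -[LHS]mulmx_ebase -rkE /B /D -!mulmxA; congr (_ *m _).
  by rewrite [RHS]mulmxA mul_pid_mx !(minn_idPr rk2).
have Bfree : row_free B^T.
  rewrite /row_free mxrank_tr eqmxMfull ?row_full_unit ?col_ebase_unit //.
  by rewrite rank_pid_mx.
(* The rows of [D] are read as coordinates of two elements of L, so that the factorization of [Ex v]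
   becomes one of [v]. *)
pose w : 'rV[K]_2 := \row_i (\sum_j D i j *: ((vbasis {:L})`_j : K)).
have vw : v = w *m (B^T)^K.
  apply/rowP => i; rewrite [LHS](coord_vbasis (memvf (v 0 i : L))) mxE.
  transitivity (\sum_j \sum_l (B i l * D l j) *: ((vbasis {:L})`_j : K)).
    apply: eq_bigr => j _; rewrite -scaler_suml; congr (_ *: _).
    by have /matrixP/(_ i j) := ExBD; rewrite !mxE.
  rewrite exchange_big; apply: eq_bigr => l _.
  rewrite !mxE mulr_algr scaler_sumr.
  by apply: eq_bigr => j _; rewrite scalerA.
have := evfree _ Bfree; rewrite -kermx_eq0 => /eqP ker0.
have /eqP : w *m eval_mx B^T == 0 by rewrite mulmx_eval_dual -vw.
by move/sub_kermxP; rewrite ker0 submx0 vw => /eqP ->; rewrite mul0mx.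
Qed.

End Code.

End RankMetric.

(** * First and second moments over the code *)

Section Moments.

Variable F : finFieldType.
Local Notation q := (#|F|%:R : rat).

Lemma q_gt1 : 1 < q.
Proof. by rewrite ltr1n finNzRing_gt1. Qed.

(** Each index satisfies l <= 1 <= n, so no natural subtraction is truncated. *)
Lemma natr_prod_expnB b n : (0 < n)%N -> (b <= 2)%N ->
  (\prod_(l < b) (#|F| ^ n - #|F| ^ l))%N%:R
    = \prod_(l < b) (q ^+ n - q ^+ l) :> rat.
Proof.
move=> n0 b2; rewrite natr_prod; apply: eq_bigr => l _.
rewrite natrB ?natrX // leq_exp2l ?finNzRing_gt1 //.
by rewrite (leq_trans _ n0) // -ltnS (leq_trans (ltn_ord l)).
Qed.

Lemma gauss_binom0 n : gauss_binom F n 0 = 1%N.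
Proof. by have := gauss_binomE F n 0; rewrite !big_ord0 muln1. Qed.

Lemma gauss_binom_diag b : gauss_binom F b b = 1%N.
Proof.
apply/eqP; rewrite -(eqn_pmul2r (m := \prod_(l < b) (#|F| ^ b - #|F| ^ l))).
  by rewrite gauss_binomE mul1n.
by apply: prodn_gt0 => l; rewrite subn_gt0 ltn_exp2l ?finNzRing_gt1.
Qed.

Lemma gauss_binom1 n : (0 < n)%N ->
  (gauss_binom F n 1)%:R * (q - 1) = q ^+ n - 1.
Proof.
move=> n0; have /(congr1 (fun x => x%:R : rat)) := gauss_binomE F n 1.
by rewrite natrM !natr_prod_expnB // !big_ord1 expr1.
Qed.

Lemma gauss_binom2 n : (0 < n)%N ->
  (gauss_binom F n 2)%:R * ((q ^+ 2 - 1) * (q ^+ 2 - q))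
    = (q ^+ n - 1) * (q ^+ n - q).
Proof.
move=> n0; have /(congr1 (fun x => x%:R : rat)) := gauss_binomE F n 2.
by rewrite natrM !natr_prod_expnB // !big_ord_recr !big_ord0 /= !mul1r !expr1.
Qed.

(** The three terms belong to ranks 0, 1 and 2. Only the last exponent stays an integer power, being
    negative for k = 1. *)
Lemma f_q02E n m k : (0 < n)%N -> (0 < k)%N ->
  f_q F n m k 0 2 = q ^+ (m * k) + q ^+ (m * (k - 1)) * ((q ^+ n - 1) * (q + 1))
     + q ^ (m%:Z * (k%:Z - 2%:Z)) * ((q ^+ n - 1) * (q ^+ n - q)).
Proof.
move=> n0 k0.
have gb21 : (gauss_binom F 2 1)%:R = q + 1.
  have q1 : q - 1 != 0 by rewrite subr_eq0 gt_eqF ?q_gt1.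
  by apply: (mulIf q1); rewrite gauss_binom1 //; ring.
rewrite /f_q big_nat_recr // big_nat_recr // big_nat1 /= !subn0.
rewrite !big_ord_recr !big_ord0 /= !gauss_binom0 gauss_binom_diag gb21.
rewrite -(gauss_binom2 n0) -(gauss_binom1 n0) subr0 (subzn k0) -!PoszM -!exprnP.
by ring.
Qed.

Variables (L : fieldExtType F) (n : nat) (C : {vspace 'rV[finvect_type L]_n}).
Local Notation m := (\dim {:L}).
Local Notation k := (\dim C).
Hypotheses (n_gt0 : (0 < n)%N) (k_gt0 : (0 < k)%N) (ndC : rk_nondegenerate C).

(** Unnormalized, with the zero word included so that the double counting runs over a whole linear
    space. *)
Definition code_moment a : rat := \sum_(v in C) q ^+ (a * (n - rk v)).

Lemma code_momentE a :
  code_moment a = \sum_(M : 'M[F]_(a, n)) q ^+ (m * (k - \rank (eval_mx C M))).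
Proof.
transitivity ((\sum_(v in C) #|F| ^ (a * (n - rk v)))%N%:R : rat).
  by rewrite natr_sum; apply: eq_bigr => v _; rewrite natrX.
by rewrite sum_rk_moment natr_sum; apply: eq_bigr => M _; rewrite natrX.
Qed.

Lemma eval_summand0 a :
  q ^+ (m * (k - \rank (eval_mx C (0 : 'M[F]_(a, n))))) = q ^+ (m * k).
Proof. by rewrite rank_eval_mx1 ?mxrank0 ?subn0. Qed.

Lemma eval_summand1 a (M : 'M[F]_(a, n)) : M != 0 -> (\rank M <= 1)%N ->
  q ^+ (m * (k - \rank (eval_mx C M))) = q ^+ (m * (k - 1)).
Proof.
move=> M0 rkM; rewrite rank_eval_mx1 //.
suff -> : \rank M = 1%N by [].
by apply/eqP; rewrite eqn_leq rkM lt0n mxrank_eq0.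
Qed.

Lemma natr_card_mx a : #|{: 'M[F]_(a, n)}|%:R = q ^+ (a * n) :> rat.
Proof. by rewrite card_mx natrX. Qed.

Lemma code_moment1 :
  code_moment 1 = q ^+ (m * k) + q ^+ (m * (k - 1)) * (q ^+ n - 1).
Proof.
rewrite code_momentE (bigD1 0) //= eval_summand0; congr (_ + _).
rewrite (eq_bigr (fun _ => q ^+ (m * (k - 1)))) => [|M M0]; last first.
  by rewrite eval_summand1 // rank_leq_row.
rewrite sumr_const -[LHS]mulr_natr; congr (_ * _).
rewrite -(mul1n n) -natr_card_mx mul1n -(cardC (pred1 (0 : 'M[F]_(1, n)))).
rewrite card1 natrD [1%:R + _]addrC addrK.
by congr (_%:R); apply: eq_card => M; rewrite !inE.
Qed.

Lemma code_moment2 :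
  code_moment 2 = f_q F n m k 0 2
    + \sum_(M : 'M[F]_(2, n) | row_free M)
        (q ^+ (m * (k - \rank (eval_mx C M))) - q ^ (m%:Z * (k%:Z - 2%:Z))).
Proof.
have card2 : #|[pred M : 'M[F]_(2, n) | row_free M]|%:R
               = (q ^+ n - 1) * (q ^+ n - q) :> rat.
  have := card_row_free F 2 n; rewrite cardsE => ->.
  by rewrite natr_prod_expnB // !big_ord_recr big_ord0 /= mul1r expr1.
rewrite code_momentE (bigID (fun M : 'M[F]_(2, n) => row_free M)) /=.
have not_free0 : ~~ row_free (0 : 'M[F]_(2, n)) by rewrite /row_free mxrank0.
rewrite addrC (bigD1 0) //= eval_summand0.
rewrite (eq_bigr (fun _ => q ^+ (m * (k - 1)))) => [|M /andP[Mfree M0]]; last first.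
  rewrite eval_summand1 // -ltnS ltn_neqAle rank_leq_row andbT.
  exact: Mfree.
rewrite sumr_const -[_ ^+ _ *+ _]mulr_natr sumrB sumr_const.
rewrite -[_ ^ _ *+ _]mulr_natr card2 f_q02E //.
(* The matrices of rank 1 are counted as what remains of all q^(2n) after the free ones and zero. *)
have -> : #|[pred M : 'M[F]_(2, n) | ~~ row_free M & M != 0]|%:R
            = (q ^+ n - 1) * (q + 1) :> rat; last by ring.
have := natr_card_mx 2.
rewrite -(cardC [pred M : 'M[F]_(2, n) | row_free M]) natrD card2.
have := cardD1 (0 : 'M[F]_(2, n)) [predC [pred M : 'M[F]_(2, n) | row_free M]].
rewrite !inE not_free0 => ->; rewrite natrD exprM => total.
apply: (addrI ((q ^+ n - 1) * (q ^+ n - q) + 1)).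
transitivity (q ^+ 2 ^+ n); last by rewrite -exprM mulnC exprM; ring.
rewrite -total -addrA; congr (_ + (_ + _)); congr (_%:R).
by apply: eq_card => M; rewrite !inE andbC.
Qed.

End Moments.


(** * From sums over the code to mean and variance over nonzero words *)

Section MeanVariance.

Variables (F : finFieldType) (L : fieldExtType F) (n : nat).
Variable C : {vspace 'rV[finvect_type L]_n}.
Hypothesis k_gt0 : (0 < \dim C)%N.
Local Notation q := (#|F|%:R : rat).
Local Notation m := (\dim {:L}).

Lemma rk0 : rk (0 : 'rV[finvect_type L]_n) = 0%N.
Proof. by rewrite rkE; apply/eqP; rewrite mxrank_eq0 expansion_eq0. Qed.

Lemma sum_nonzero_words (g : 'rV[finvect_type L]_n -> rat) :
  \sum_(v in nonzero_words C) g v = \sum_(v in C) g v - g 0.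
Proof.
rewrite [in RHS](bigD1 0) ?mem0v //= addrAC subrr add0r.
by apply: eq_bigl => v; rewrite inE.
Qed.

Lemma card_nonzero_words :
  #|nonzero_words C|%:R = q ^+ (m * \dim C) - 1 :> rat.
Proof.
rewrite -sumr_const sum_nonzero_words sumr_const card_vspace card_finvect.
by rewrite -expnM natrX.
Qed.

Lemma nonzero_words_gt0 : 0 < q ^+ (m * \dim C) - 1.
Proof.
by rewrite subr_gt0 exprn_egt1 ?q_gt1 // -lt0n muln_gt0 k_gt0 adim_gt0.
Qed.

(** The subtracted q^(a n) is the contribution of the zero word, of rank 0. *)
Lemma rk_mean_moment a :
  rk_mean C (fun w => q ^+ (a * (n - w)))
    = (code_moment C a - q ^+ (a * n)) / (q ^+ (m * \dim C) - 1).
Proof.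
by rewrite /rk_mean sum_nonzero_words rk0 subn0 card_nonzero_words.
Qed.

Lemma rk_varianceE (g : nat -> rat) :
  rk_variance C g = rk_mean C (fun w => g w ^+ 2) - rk_mean C g ^+ 2.
Proof.
rewrite /rk_variance; set mu := rk_mean C g; rewrite /rk_mean.
under eq_bigr do rewrite sqrrB -addrA.
rewrite big_split /= big_split /= sumr_const sumrN sumrMnl -mulr_suml.
have N0 : #|nonzero_words C|%:R != 0 :> rat.
  by rewrite card_nonzero_words gt_eqF ?nonzero_words_gt0.
have -> : \sum_(v in nonzero_words C) g (rk v) = mu * #|nonzero_words C|%:R.
  by rewrite /mu /rk_mean mulfVK.
by rewrite -[mu ^+ 2 *+ _]mulr_natr; field.
Qed.

End MeanVariance.

(** * Sign of the excess and the equality case *)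

Theorem corollary4p14 (q n m k d : nat) (F : finFieldType) (L : fieldExtType F)
    (C : {vspace 'rV[finvect_type L]_n})
    (hq : #|F| = q) (hm : \dim {:L} = m) (hn : (0 < n)%N) (hk : (0 < k)%N)
    (dimC : \dim C = k) (distC : min_rk_dist C = d)
    (ndC : rk_nondegenerate C) :
  let Q : rat := q%:R in
  let X := fun w : nat => Q ^+ (n - w) in
  let bound := (- Q ^+ (2 * n) + f_q F n m k 0 2) / (Q ^+ (m * k) - 1)
               - rk_mean C X ^+ 2 in
  [/\ rk_mean C X = (- Q ^+ n + Q ^+ (m * k) + Q ^+ (m * (k - 1)) * (Q ^+ n - 1))
                    / (Q ^+ (m * k) - 1),
      bound <= rk_variance C X
    & (2 <= n)%N -> (rk_variance C X = bound <-> rk_2_nondegenerate C)].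
Proof.
subst q m k; move=> Q X bound.
have X1 : rk_mean C X = rk_mean C (fun w => Q ^+ (1 * (n - w))).
  by rewrite /rk_mean; congr (_ / _); apply: eq_bigr => v _; rewrite mul1n.
have mean2 : rk_mean C (fun w => X w ^+ 2)
    = (code_moment C 2 - Q ^+ (2 * n)) / (Q ^+ (\dim {:L} * \dim C) - 1).
  rewrite -rk_mean_moment /rk_mean; congr (_ / _).
  by apply: eq_bigr => v _; rewrite -exprM mulnC.
have N_gt0 := nonzero_words_gt0 hk.
pose excess (M : 'M[F]_(2, n)) : rat :=
  Q ^+ (\dim {:L} * (\dim C - \rank (eval_mx C M)))
  - Q ^ ((\dim {:L})%:Z * ((\dim C)%:Z - 2%:Z)).
(* The rank is at most the number k of columns, so the natural and the integer exponent agree and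
   monotonicity of integer powers applies, also for k = 1. *)
have excessE M : excess M = Q ^ ((\dim {:L})%:Z * ((\dim C)%:Z
    - (\rank (eval_mx C M))%:Z)) - Q ^ ((\dim {:L})%:Z * ((\dim C)%:Z - 2%:Z)).
  by rewrite subzn ?rank_leq_col // -PoszM -exprnP.
have excess_ge0 M : 0 <= excess M.
  rewrite excessE subr_ge0 ler_eXz2l ?q_gt1 // ler_pM2l ?ltz_nat ?adim_gt0 //.
  by rewrite lerB // lez_nat rank_leq_row.
have excess_eq0 M : (excess M == 0) = row_free (eval_mx C M).
  have q_inj : injective (exprz Q).
    by apply: ieexprIz; rewrite ?gt_eqF ?(lt_trans ltr01) ?q_gt1.
  have m_neq0 : (\dim {:L})%:Z != 0 by rewrite eqz_nat -lt0n adim_gt0.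
  rewrite excessE subr_eq0 (inj_eq q_inj) (inj_eq (mulfI m_neq0)).
  by rewrite (inj_eq (addrI _)) eqr_opp eqz_nat.
have varE : rk_variance C X
    = bound + (\sum_(M : 'M[F]_(2, n) | row_free M) excess M)
              / (Q ^+ (\dim {:L} * \dim C) - 1).
  by rewrite rk_varianceE // mean2 code_moment2 // /bound; ring.
have sum_ge0 : 0 <= \sum_(M : 'M[F]_(2, n) | row_free M) excess M.
  by apply: sumr_ge0.
split.
- rewrite X1 rk_mean_moment code_moment1 // mul1n; congr (_ / _); ring.
- by rewrite varE lerDl; apply: divr_ge0 (ltW N_gt0).
- move=> n2; rewrite varE rk_2_nondegenerateP //; split.
    move=> /eqP; rewrite -subr_eq0 [bound + _]addrC addrK.
    (* A vanishing sum of nonnegative terms has only zero terms. *)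
    rewrite mulf_eq0 invr_eq0 (gt_eqF N_gt0) orbF => /eqP/psumr_eq0P excess0 M Mfree.
    by rewrite -excess_eq0 excess0.
  move=> evfree; rewrite big1 ?mul0r ?addr0 // => M Mfree.
  by apply/eqP; rewrite excess_eq0 evfree.
Qed.
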